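(* The statistics constants satisfy $\lambda(3,2)=8/9$, $\lambda(4,2)=264/343$ and $\lambda(4,4)=26/27$.
   Context: A $d$-subcube of $\{0,1\}^n$ is a set $C\subseteq\{0,1\}^n$ obtained by fixing $n-d$ coordinates to constant values and letting the remaining $d$ coordinates vary arbitrarily; there are $\binom nd 2^{n-d}$ of them. For integers $0\le s\le 2^d$ and $S\subseteq\{0,1\}^n$, let $\Lambda(S,d,s)$ be the number of $d$-subcubes $C$ with $|S\cap C|=s$, let $\Lambda(n,d,s)=\max\{\Lambda(S,d,s): S\subseteq\{0,1\}^n\}$ for $n\ge d$, and let the statistics constant be $\lambda(d,s)=\lim_{n\to\infty}\Lambda(n,d,s)/\big(\binom nd 2^{n-d}\big)$ (the limit exists since the ratio is non-increasing in $n$). *)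

(* Defs.v *)
From HB Require Import structures.
From mathcomp Require Import all_boot all_order all_algebra.
From mathcomp Require Import all_classical all_reals all_analysis.
Set Implicit Arguments. Unset Strict Implicit. Unset Printing Implicit Defensive.
Import Order.TTheory GRing.Theory Num.Theory.

Definition point (n : nat) := {ffun 'I_n -> bool}.

Definition is_subcube (n d : nat) (C : {set point n}) : bool :=
  [exists D : {set 'I_n}, [exists a : point n,
     (#|D| == d) && (C == [set x : point n | [forall i, (i \notin D) ==> (x i == a i)]])]].

Definition LambdaS (n : nat) (S : {set point n}) (d s : nat) : nat :=
  #|[set C : {set point n} | is_subcube d C && (#|S :&: C| == s)]|.

Definition Lambda (n d s : nat) : nat :=
  \max_(S : {set point n}) LambdaS S d s.

Definition lambda_ratio (R : realType) (d s n : nat) : R :=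
  ((Lambda n d s)%:R / ('C(n, d) * 2 ^ (n - d))%:R)%R.

(* Main.v *)
From HB Require Import structures.
From Stdlib Require Import ZArith.
From mathcomp Require Import all_boot all_order all_algebra ssrZ zify.
From mathcomp Require Import all_classical all_reals all_analysis.
From mathcomp Require Import fintype finset.
Require Import Defs.
Import Order.TTheory GRing.Theory Num.Theory numFieldNormedType.Exports.
Set Implicit Arguments. Unset Strict Implicit. Unset Printing Implicit Defensive.
Local Open Scope ring_scope.

(** Lower bounds: label the coordinates cyclically by the nonzero vectors of
    F_2^r (r = 2 or 3) and let S be the kernel of the resulting linear map. A
    d-subcube whose d labels span F_2^r meets S in exactly 2^(d-r) points, and
    four (three) random labels span with probability 26/27 and 264/343 (8/9).

    Upper bounds: take a uniform point x and independent uniform directions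
    i, j, k, l, possibly repeated, and look at the trace of S on the 4-cube they
    span at x; its law is invariant under the symmetries of the cube. Conditioned
    on x (or on x and one or two of the directions) the remaining directions are
    independent, so suitable products of flag functions have the expectation of a
    square. In each case some positive combination of such squares, symmetrised
    and added to the indicator of the traces being counted, is at most the claimed
    constant at every one of the 2^16 possible traces; averaging gives the bound. *)

(** * Patterns on the 4-cube and their symmetries *)

Definition swap T (a : T * T) := (a.2, a.1).
Definition twist T (a : (T * T) * (T * T)) := ((a.1.1, a.2.1), (a.1.2, a.2.2)).
Definition both T U (g : T -> U) (a : T * T) := (g a.1, g a.2).

(* A pattern is a full binary tree whose depth-k branching is the k-th
   coordinate; [swap] and [twist], lifted by [both], flip one coordinate and
   exchange two consecutive ones. *)
Definition pat3 :=
  (((bool * bool) * (bool * bool)) * ((bool * bool) * (bool * bool)))%type.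
Definition pat4 := (pat3 * pat3)%type.

Definition gens3 : seq (pat3 -> pat3) :=
  [:: @swap _; both (@swap _); both (both (@swap _)); @twist _; both (@twist _)].
Definition gens4 : seq (pat4 -> pat4) :=
  [:: @swap _, @twist _ & [seq both g | g <- gens3]].

Section Symmetrisation.
Local Open Scope Z_scope.
Implicit Types (F G : pat4 -> Z) (A : pat4).

Definition plus_image (g : pat4 -> pat4) F A := F A + F (g A).

Definition sum_flips F :=
  plus_image (@swap _) (plus_image (both (@swap _))
    (plus_image (both (both (@swap _)))
      (plus_image (both (both (both (@swap _)))) F))).

(** The 24 permutations arise from coset representatives along S_2 < S_3 < S_4, with 2, 3 and 4
    terms at the three stages. *)
Definition sum_perms F : pat4 -> Z :=
  let s1 : pat4 -> pat4 := @twist _ in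
  let s2 : pat4 -> pat4 := both (@twist _) in
  let s3 : pat4 -> pat4 := both (both (@twist _)) in
  let F3 A := F A + F (s3 A) in
  let F2 A := F3 A + F3 (s2 A) + F3 (s2 (s3 A)) in
  fun A => F2 A + F2 (s1 A) + F2 (s1 (s2 A)) + F2 (s1 (s2 (s3 A))).

Definition sum_sym F := sum_flips (sum_perms F).

Lemma eq_sum_flips F G : F =1 G -> sum_flips F =1 sum_flips G.
Proof. by move=> eFG A; rewrite /sum_flips /plus_image !eFG. Qed.

Local Ltac by_leaves A :=
  destruct A as [[[[? ?] [? ?]] [[? ?] [? ?]]] [[[? ?] [? ?]] [[? ?] [? ?]]]];
  cbv [sum_perms sum_flips plus_image both swap twist fst snd pat3 pat4];
  lazymatch goal with |- @eq _ ?x ?y => change (@eq Z x y) end; ring.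

(** An exchange of coordinates normalises the group of flips, so it moves past [sum_flips] and is
    then absorbed by [sum_perms]. Separating the two keeps each [ring] identity at 16 or 24 terms
    instead of 384. *)
Lemma sum_sym_twist (g : pat4 -> pat4) F :
    (forall A, sum_perms F (g A) = sum_perms F A) ->
    (forall G A, sum_flips G (g A) = sum_flips (fun B => G (g B)) A) ->
  forall A, sum_sym F (g A) = sum_sym F A.
Proof. by move=> permsg flipsg A; rewrite /sum_sym flipsg; apply: eq_sum_flips. Qed.

Lemma sum_sym_gens F A : all (fun g => sum_sym F (g A) == sum_sym F A) gens4.
Proof.
apply/and5P; split; last apply/and4P; try split=> //; apply/eqP.
(* A flip only permutes the 16 terms of [sum_flips], whatever the summand, so [sum_perms F] can stay
   opaque. *)
- rewrite /sum_sym; set G := sum_perms F; by_leaves A.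
- by apply: (@sum_sym_twist (@twist _)) => [{}A|G {}A]; by_leaves A.
- rewrite /sum_sym; set G := sum_perms F; by_leaves A.
- rewrite /sum_sym; set G := sum_perms F; by_leaves A.
- rewrite /sum_sym; set G := sum_perms F; by_leaves A.
- by apply: (@sum_sym_twist (both (@twist _))) => [{}A|G {}A]; by_leaves A.
- by apply: (@sum_sym_twist (both (both (@twist _)))) => [{}A|G {}A]; by_leaves A.
Qed.

End Symmetrisation.

(** * Exhaustive verification up to symmetry *)

Definition allb (f : bool -> bool) := f false && f true.
Definition all_prod T (q : (T -> bool) -> bool) (f : T * T -> bool) :=
  q (fun a => q (fun b => f (a, b))).
Definition all_pat3 : (pat3 -> bool) -> bool := all_prod (all_prod (all_prod allb)).

Definition lexb T (lt : rel T) : rel (T * T) :=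
  fun a b => lt a.1 b.1 || (~~ lt b.1 a.1 && lt a.2 b.2).
Definition lt_pat3 : rel pat3 := lexb (lexb (lexb (fun a b => ~~ a && b))).
Definition lt_pat4 : rel pat4 := lexb lt_pat3.

(* [P] is only evaluated at the patterns that no generator makes
   lexicographically smaller; [if] rather than [||] because the latter is
   strict under call by value. *)
Definition all_min_pat4 (P : pat4 -> bool) :=
  all_pat3 (fun B => if has (fun g => lt_pat3 (g B) B) gens3 then true else
    all_pat3 (fun C =>
      if has (fun g => lt_pat4 (g (B, C)) (B, C)) gens4 then true else P (B, C))).

Lemma all_prodP T (q : (T -> bool) -> bool) :
    (forall f, q f -> forall a, f a) ->
  forall f, all_prod q f -> forall a, f a.
Proof. by move=> qP f /qP fP [a b]; have /qP := fP a; apply. Qed.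

Lemma all_pat3P f : all_pat3 f -> forall B, f B.
Proof.
apply: all_prodP; apply: all_prodP; apply: all_prodP.
by move=> {}f /andP[f0 f1] [].
Qed.

Definition lex_measure T (m : T -> nat) K (a : T * T) := (m a.1 * K + m a.2)%N.

(** Pairs are read as two-digit numerals in base [K]. Iterating this ranks the patterns by natural
    numbers, which makes descent along the order well founded. *)
Lemma lexb_measure T (lt : rel T) (m : T -> nat) K :
    (forall a, m a < K)%N -> (forall a b, lt a b = (m a < m b)%N) ->
  (forall a, lex_measure m K a < K * K)%N /\
  (forall a b, lexb lt a b = (lex_measure m K a < lex_measure m K b)%N).
Proof.
move=> mK ltm; split=> [[a1 a2]|[a1 a2] [b1 b2]]; rewrite /lexb /lex_measure /=.
  by have := mK a1; have := mK a2; nia.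
rewrite !ltm; have := mK a2; have := mK b2; move: (m a1) (m a2) (m b1) (m b2).
by move=> x y u v vK yK; apply/idP/idP; nia.
Qed.

Lemma lt_pat4_measure : exists m : pat4 -> nat,
  forall A B, lt_pat4 A B = (m A < m B)%N.
Proof.
have m0 : (forall a : bool, nat_of_bool a < 2)%N by case.
have l0 (a b : bool) : ~~ a && b = (nat_of_bool a < nat_of_bool b)%N.
  by case: a b => [] [].
have [m1 l1] := lexb_measure m0 l0; have [m2 l2] := lexb_measure m1 l1.
have [m3 l3] := lexb_measure m2 l2; have [_ l4] := lexb_measure m3 l3.
by eexists; exact: l4.
Qed.

(** Descent on the rank: if some generator lowers the pattern, invariance carries [P] back from the
    smaller image; otherwise the check has evaluated [P] there. *)
Lemma all_min_pat4P (P : pat4 -> bool) :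
    (forall A, all (fun g => P (g A) == P A) gens4) ->
  all_min_pat4 P -> forall A, P A.
Proof.
move=> Pg minP A; have [m ltm] := lt_pat4_measure.
have [k] := ubnP (m A); elim: k A => // k IHk [B C] /ltnSE leAk.
have step g : lt_pat4 (g (B, C)) (B, C) -> P (g (B, C)).
  by rewrite ltm => ltg; apply: IHk; apply: leq_trans ltg leAk.
have /all_pat3P/(_ B) := minP; case: ifP => [/(has_nthP id)[i si ltB] _|_].
  (* Two generators precede the lifts of [gens3] in [gens4], hence the shift. The first half is the
     more significant one, so lowering it lowers the pattern. *)
  have /(all_nthP id)/(_ i.+2 si)/eqP <- := Pg (B, C); apply: step.
  by rewrite [nth _ _ _](nth_map id) // /lt_pat4 /lexb /= ltB.
move=> /all_pat3P/(_ C); case: ifP => // /(has_nthP id)[i si ltA] _.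
have /(all_nthP id)/(_ i si)/eqP <- := Pg (B, C); exact: step.
Qed.

(** * Positive semidefinite kernels on rooted flags *)

Definition flag := (bool * bool * bool)%type.

Section Kernels.
Local Open Scope Z_scope.

Definition kernel (c : seq (Z * (flag -> Z))) (p q : flag) : Z :=
  foldr (fun wf z => wf.1 * (wf.2 p * wf.2 q) + z) 0 c.

(** Tabulates [f] at the eight flags, so that [vm_compute] evaluates a kernel once and not at every
    pattern. *)
Definition memo T (f : flag -> T) :=
  let g p := let h q := (f (p, q, false), f (p, q, true)) in (h false, h true) in
  (g false, g true).
Definition pick T (b : bool) (a : T * T) := if b then a.2 else a.1.
Definition look T (t : ((T * T) * (T * T)) * ((T * T) * (T * T))) (p : flag) :=
  pick p.2 (pick p.1.2 (pick p.1.1 t)).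
Definition table c := memo (fun p => memo (kernel c p)).

Definition leaf (A : pat4) i j k l := pick l (pick k (pick j (pick i A))).

(* The labelled part of the pattern is the point x, an edge at x or a face at x.
   The two flags extending it are independent given the labelled part, so each
   square of the kernel contributes the average of a square. *)
Definition rooted_pair t0 t1 (A : pat4) : Z :=
  let a := leaf A in
  look (look (if a false false false false then t1 else t0)
    (a true false false false, a false true false false, a true true false false))
    (a false false true false, a false false false true, a false false true true).

Definition rooted_edge t0 t1 (A : pat4) : Z :=
  let a := leaf A in
  if a true false false false then 0 else
  look (look (if a false false false false then t1 else t0)
    (a false true false false, a true true false false, false))
    (a false false true false, a true false true false, false).

Definition rooted_face t (A : pat4) : Z :=
  let a := leaf A in
  if [&& a false false false false, ~~ a true false false false,
         ~~ a false true false false & ~~ a true true false false]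
  then look (look t
    (a true false true false, a false true true false, a true true true false))
    (a true false false true, a false true false true, a true true false true)
  else 0.

Lemma lookK T (f : flag -> T) p : look (memo f) p = f p.
Proof. by case: p => [[[] []] []]. Qed.

Lemma look_table c p q : look (look (table c) p) q = kernel c p q.
Proof. by rewrite !lookK. Qed.

End Kernels.

(** Each rank-one term factors as its weight times the square of a single sum. *)
Lemma kernel_psd (I : finType) (f : I -> flag) c :
  all (fun wf => 0 <= wf.1) c -> 0 <= \sum_a \sum_b kernel c (f a) (f b).
Proof.
elim: c => [_|[w g] c IHc /= /andP[w0 /IHc{}IHc]].
  by rewrite big1 // => a _; rewrite big1.
rewrite [X in _ <= X](_ : _ = w * (\sum_a g (f a)) ^+ 2
    + \sum_a \sum_b kernel c (f a) (f b)); last first.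
  rewrite expr2 mulr_suml mulr_sumr -big_split; apply: eq_bigr => a _ /=.
  by rewrite mulr_sumr mulr_sumr -big_split; apply: eq_bigr.
by rewrite addr_ge0 // mulr_ge0 // sqr_ge0.
Qed.

(** * Averages over random subcubes *)

Section Cubes.
Context (n : nat) (S : {set point n}).
Implicit Types (x : point n) (i j k l : 'I_n) (F : pat4 -> Z) (A : pat4).

Definition flip i x : point n := [ffun j => x j (+) (j == i)].

Lemma flipK i : involutive (flip i).
Proof. by move=> x; apply/ffunP => j; rewrite !ffunE addbK. Qed.

Lemma flipC i j x : flip i (flip j x) = flip j (flip i x).
Proof. by apply/ffunP => k; rewrite !ffunE addbAC. Qed.

Definition edge T i (h : point n -> T) x := (h x, h (flip i x)).
Definition cube i j k l : point n -> pat4 :=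
  edge i (edge j (edge k (edge l (fun x => x \in S)))).

(* Repeated directions are allowed: this makes the positivity statements below
   exact, and costs only a factor [1 + O(1/n)] in the end. *)
Definition total F : Z :=
  \sum_(p : point n * 'I_n * 'I_n * 'I_n * 'I_n)
    let: (x, i, j, k, l) := p in F (cube i j k l x).

Lemma total_nested F :
  total F = \sum_x \sum_i \sum_j \sum_k \sum_l F (cube i j k l x).
Proof. by rewrite /total !pair_bigA; apply: eq_bigr => -[[[[x i] j] k] l]. Qed.

Lemma total_sum F G : total (fun A => F A + G A) = total F + total G.
Proof. by rewrite -big_split; apply: eq_bigr => -[[[[x i] j] k] l]. Qed.

Lemma total_scale (c : Z) F : total (fun A => c * F A) = c * total F.
Proof. by rewrite mulr_sumr; apply: eq_bigr => -[[[[x i] j] k] l]. Qed.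

Definition preserving (g : pat4 -> pat4) := forall F, total (fun A => F (g A)) = total F.

Lemma preserving_comp g h :
  preserving g -> preserving h -> preserving (fun A => g (h A)).
Proof. by move=> pg ph F; rewrite -(pg F) (ph (fun A => F (g A))). Qed.

(** A symmetry acting on the trace amounts to a new base point or a new order of directions, that
    is, to a reindexing of the sum. *)
Lemma preserving_reindex g (h : _ -> point n * 'I_n * 'I_n * 'I_n * 'I_n) :
    involutive h ->
    (forall x i j k l, g (cube i j k l x) =
       let: (x', i', j', k', l') := h (x, i, j, k, l) in cube i' j' k' l' x') ->
  preserving g.
Proof.
move=> hK gh F; rewrite [RHS](reindex_inj (inv_inj hK)).
by apply: eq_bigr => -[[[[x i] j] k] l] _; rewrite gh; case: (h _) => [[[[]]]].
Qed.

Lemma swap_edge T i (h : point n -> T) x : swap (edge i h x) = edge i h (flip i x).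
Proof. by rewrite /swap /edge /= flipK. Qed.

Lemma twist_edge T i j (h : point n -> T) x :
  twist (edge i (edge j h) x) = edge j (edge i h) x.
Proof. by rewrite /twist /edge /= flipC. Qed.

Lemma edge_flip T i j (h : point n -> T) x :
  edge i (fun y => h (flip j y)) x = edge i h (flip j x).
Proof. by rewrite /edge flipC. Qed.

Lemma both_edge T U i (g : T -> U) (h : point n -> T) (h' : point n -> U) x :
  (forall y, g (h y) = h' y) -> both g (edge i h x) = edge i h' x.
Proof. by move=> gh; rewrite /both /edge /= !gh. Qed.

Lemma both_edge_flip T i j (g : T -> T) (h : point n -> T) x :
  (forall y, g (h y) = h (flip j y)) -> both g (edge i h x) = edge i h (flip j x).
Proof. by move=> gh; rewrite (both_edge i x gh) edge_flip. Qed.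

Lemma preserving_swap1 : preserving (@swap _).
Proof.
apply: (@preserving_reindex _ (fun p =>
  let: (x, i, j, k, l) := p in (flip i x, i, j, k, l))).
  by move=> [[[[x i] j] k] l]; rewrite flipK.
by move=> x i j k l; apply: swap_edge.
Qed.

Lemma preserving_swap2 : preserving (both (@swap _)).
Proof.
apply: (@preserving_reindex _ (fun p =>
  let: (x, i, j, k, l) := p in (flip j x, i, j, k, l))).
  by move=> [[[[x i] j] k] l]; rewrite flipK.
by move=> x i j k l; apply: both_edge_flip => y; apply: swap_edge.
Qed.

Lemma preserving_swap3 : preserving (both (both (@swap _))).
Proof.
apply: (@preserving_reindex _ (fun p =>
  let: (x, i, j, k, l) := p in (flip k x, i, j, k, l))).
  by move=> [[[[x i] j] k] l]; rewrite flipK.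
by move=> x i j k l; do 2!apply: both_edge_flip => ?; apply: swap_edge.
Qed.

Lemma preserving_swap4 : preserving (both (both (both (@swap _)))).
Proof.
apply: (@preserving_reindex _ (fun p =>
  let: (x, i, j, k, l) := p in (flip l x, i, j, k, l))).
  by move=> [[[[x i] j] k] l]; rewrite flipK.
by move=> x i j k l; do 3!apply: both_edge_flip => ?; apply: swap_edge.
Qed.

Lemma preserving_twist1 : preserving (@twist _).
Proof.
apply: (@preserving_reindex _ (fun p =>
  let: (x, i, j, k, l) := p in (x, j, i, k, l))).
  by move=> [[[[x i] j] k] l].
by move=> x i j k l; apply: twist_edge.
Qed.

Lemma preserving_twist2 : preserving (both (@twist _)).
Proof.
apply: (@preserving_reindex _ (fun p =>
  let: (x, i, j, k, l) := p in (x, i, k, j, l))).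
  by move=> [[[[x i] j] k] l].
by move=> x i j k l; apply: both_edge => y; apply: twist_edge.
Qed.

Lemma preserving_twist3 : preserving (both (both (@twist _))).
Proof.
apply: (@preserving_reindex _ (fun p =>
  let: (x, i, j, k, l) := p in (x, i, j, l, k))).
  by move=> [[[[x i] j] k] l].
by move=> x i j k l; do 2!apply: both_edge => ?; apply: twist_edge.
Qed.

Lemma total_plus_image g F : preserving g -> total (plus_image g F) = total F *+ 2.
Proof. by move=> pg; rewrite [LHS]total_sum pg. Qed.

Lemma total_sum_perms F : total (sum_perms F) = total F *+ 24.
Proof.
have p1 := preserving_twist1; have p2 := preserving_twist2; have p3 := preserving_twist3.
have p12 := preserving_comp p1 p2; have p23 := preserving_comp p2 p3.
have p123 := preserving_comp p1 p23.
pose F3 A := F A + F (both (both (@twist _)) A).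
pose F2 A := F3 A + F3 (both (@twist _) A)
  + F3 (both (@twist _) (both (both (@twist _)) A)).
have tF3 : total F3 = total F *+ 2 by rewrite [LHS]total_sum (p3 F).
have tF2 : total F2 = total F3 *+ 3.
  rewrite [LHS](total_sum (fun A => F3 A + F3 (both (@twist _) A))) total_sum.
  by rewrite (p2 F3) (p23 F3) -addrA.
rewrite [LHS](total_sum (fun A => F2 A + F2 (twist A) + F2 (twist (both (@twist _) A)))).
rewrite (total_sum (fun A => F2 A + F2 (twist A))) total_sum (p1 F2) (p12 F2) (p123 F2).
by rewrite tF2 tF3 -!mulrnA -!mulrnDr.
Qed.

Lemma total_sum_sym F : total (sum_sym F) = total F *+ 384.
Proof.
rewrite /sum_sym /sum_flips !total_plus_image ?total_sum_perms -?mulrnA //.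
- exact: preserving_swap4.
- exact: preserving_swap3.
- exact: preserving_swap2.
- exact: preserving_swap1.
Qed.

Lemma total_le (c : Z) F : (forall A, F A <= c) -> total F <= c *+ (2 ^ n * n ^ 4).
Proof.
move=> Fc; apply: (@le_trans _ _ (total (fun=> c))).
  by apply: ler_sum => -[[[[x i] j] k] l].
rewrite total_nested !sumr_const !card_ord -!mulrnA card_ffun card_bool card_ord.
by rewrite [(2 ^ n * _)%N]mulnC !expnS expn0 muln1 -!mulnA.
Qed.

Lemma total_rooted_pair c0 c1 :
    all (fun wf => 0 <= wf.1) c0 -> all (fun wf => 0 <= wf.1) c1 ->
  0 <= total (rooted_pair (table c0) (table c1)).
Proof.
move=> c0_ge0 c1_ge0; rewrite total_nested sumr_ge0 // => x _.
pose f (p : 'I_n * 'I_n) : flag :=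
  (flip p.1 x \in S, flip p.2 x \in S, flip p.2 (flip p.1 x) \in S).
rewrite [X in _ <= X](_ : _ = \sum_a \sum_b
    kernel (if x \in S then c1 else c0) (f a) (f b)).
  by apply: kernel_psd; case: ifP.
rewrite pair_bigA; apply: eq_bigr => -[i j] _.
rewrite pair_bigA; apply: eq_bigr => -[k l] _.
by rewrite /rooted_pair /= -look_table; case: (x \in S).
Qed.

Lemma total_rooted_face c :
  all (fun wf => 0 <= wf.1) c -> 0 <= total (rooted_face (table c)).
Proof.
move=> c_ge0; rewrite total_nested sumr_ge0 // => x _.
rewrite sumr_ge0 // => i _; rewrite sumr_ge0 // => j _.
have [sigma|/negPf sigma] := boolP [&& x \in S, flip i x \notin S,
    flip j x \notin S & flip j (flip i x) \notin S]; last first.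
  by rewrite big1 // => k _; rewrite big1 // => l _; rewrite /rooted_face /= sigma.
pose f k : flag := (flip k (flip i x) \in S, flip k (flip j x) \in S,
  flip k (flip j (flip i x)) \in S).
rewrite [X in _ <= X](_ : _ = \sum_a \sum_b kernel c (f a) (f b)).
  exact: kernel_psd.
by apply: eq_bigr => k _; apply: eq_bigr => l _; rewrite /rooted_face /= sigma look_table.
Qed.

Lemma total_rooted_edge c0 c1 :
    all (fun wf => 0 <= wf.1) c0 -> all (fun wf => 0 <= wf.1) c1 ->
  0 <= total (rooted_edge (table c0) (table c1)).
Proof.
move=> c0_ge0 c1_ge0; rewrite total_nested sumr_ge0 // => x _.
rewrite sumr_ge0 // => i _; have [ixS|/negPf ixS] := boolP (flip i x \in S).
  rewrite big1 // => j _; rewrite big1 // => k _; rewrite big1 // => l _.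
  by rewrite /rooted_edge /= ixS.
pose f j : flag := (flip j x \in S, flip j (flip i x) \in S, false).
(* The two flags use the directions j and k; the sum over l contributes the factor n. *)
rewrite [X in _ <= X](_ : _ = (\sum_a \sum_b
    kernel (if x \in S then c1 else c0) (f a) (f b)) *+ n).
  by rewrite mulrn_wge0 //; apply: kernel_psd; case: ifP.
rewrite -sumrMnl; apply: eq_bigr => j _; rewrite -sumrMnl; apply: eq_bigr => k _.
set K := kernel _ _ _; transitivity (\sum_(l < n) K); last by rewrite sumr_const card_ord.
by apply: eq_bigr => l _; rewrite /K /rooted_edge /= ixS -look_table; case: (x \in S).
Qed.

End Cubes.

(** Symmetrising multiplies a total by 384 = 2^4 * 4!, so the pointwise check bounds the total of
    [good + F], from which the nonnegative part [F] is dropped. *)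
Lemma total_bound n (S : {set point n}) (b : Z) (good F : pat4 -> Z) :
    0 <= total S F ->
    all_min_pat4 (fun A => Z.leb (sum_sym (fun A => good A + F A) A) (384 * b)) ->
  total S good <= b *+ (2 ^ n * n ^ 4).
Proof.
move=> F_ge0 /all_min_pat4P chk.
have {chk} /(total_le S) : forall A, sum_sym (fun A => good A + F A) A <= 384 * b.
  apply: chk => A; have := sum_sym_gens (fun A => good A + F A) A.
  by apply: sub_all => g /eqP ->.
rewrite total_sum_sym total_sum [384 * b]mulr_natl mulrnAC lerMn2r /=.
by apply: le_trans; rewrite lerDl.
Qed.

(** * The sum-of-squares certificates *)

Section Certificates.
Local Open Scope Z_scope.

Definition ind (b : bool) : Z := if b then 1 else 0.

Definition count2 (a : bool * bool) := (a.1 + a.2)%N.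
Definition count_prod T (f : T -> nat) (a : T * T) := (f a.1 + f a.2)%N.
Definition count3 : pat3 -> nat := count_prod (count_prod count2).
Definition count4 : pat4 -> nat := count_prod count3.

(** Keeps the leaves with the fourth direction unflipped, so that the 3-cube problem is treated on
    4-cube patterns. *)
Definition facet : pat4 -> pat3 := both (both (both fst)).

(* The weights and vectors below come from a semidefinite program. All squares
   vanish on the extremal configurations; the scaling clears denominators. *)
Definition edge_flag (f : Z -> Z -> Z -> Z) (x : flag) :=
  let: (p, q, _) := x in f (ind p) (ind q) (ind (p && q)).
Definition edge_out32 : seq (Z * (flag -> Z)) :=
  [:: (4, edge_flag (fun p q pq => 3 * p + 3 * q - 2));
      (8, edge_flag (fun p q pq => 3 * q - 3 * pq - 1))].
Definition edge_in32 : seq (Z * (flag -> Z)) :=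
  [:: (12, edge_flag (fun p q pq => 3 * q - 3 * pq - 1))].

Definition pair_flag (f : Z -> Z -> Z -> Z -> Z -> Z) (x : flag) :=
  let: (a, b, c) := x in
  f (ind a + ind b) (ind c) (ind (a && b)) (ind (a && c) + ind (b && c))
    (ind [&& a, b & c]).
Definition pair_out44 : seq (Z * (flag -> Z)) :=
  [:: (10, pair_flag (fun u c ab m abc => 9 * u + 9 * m - 27 * abc - 6));
      (81, pair_flag (fun u c ab m abc => 9 * u + 9 * c - 9 * abc - 8));
      (18, pair_flag (fun u c ab m abc => 9 * c - 9 * m + 18 * abc - 2))].
Definition pair_in44 : seq (Z * (flag -> Z)) :=
  [:: (405, pair_flag (fun u c ab m abc => 3 * c - 1))].

(** The constants centre the statistics: for a root outside the kernel and uniform nonzero labels in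
    F_2^3, the means of [u], [c], [ab] are 14/49, 6/49, 1/49, and [m], [abc] vanish. *)
Definition pair_comb (c1 c2 c3 c4 c5 : Z) : flag -> Z :=
  pair_flag (fun u c ab m abc =>
    c1 * (49 * u - 14) + c2 * (49 * c - 6) + c3 * (49 * ab - 1)
    + c4 * (49 * m) + c5 * (49 * abc)).
Definition pair_out42 : seq (Z * (flag -> Z)) :=
  [:: (526509, pair_comb 2 2 (-4) (-3) 3); (112320, pair_comb 3 2 (-4) (-2) 3);
      (115776, pair_comb 1 1 (-4) (-1) 2); (511308, pair_comb 2 1 (-4) (-1) 1)].
(** In the same configuration the two labels of the rooted face are distinct, so each entry has mean
    1/7 and no two hold together. *)
Definition face_comb (c1 c2 c3 c4 c5 : Z) (x : flag) : Z :=
  let: (a, b, c) := x in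
  c1 * (7 * ind a - 1) + c2 * (7 * ind b - 1) + c3 * (7 * ind c - 1)
  + c4 * (7 * ind (a && b)) + c5 * (7 * ind (a && c)).
Definition face42 : seq (Z * (flag -> Z)) :=
  [:: (54945954, face_comb 3 1 1 (-3) (-2)); (18227216, face_comb 3 0 0 (-2) (-1));
      (34439454, face_comb 2 2 0 (-3) (-2)); (25570062, face_comb 3 (-3) 3 (-3) (-2))].

(** In the three checks the bound over the weight of the indicator is the claimed constant: 24/27 =
    8/9, 1452971520/1887762240 = 264/343 and 5616/5832 = 26/27. *)
Lemma certificate32 : let t0 := table edge_out32 in let t1 := table edge_in32 in
  all_min_pat4 (fun A => Z.leb (sum_sym (fun A =>
    27 * ind (count3 (facet A) == 2%N) + rooted_edge t0 t1 A) A) (384 * 24)).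
Proof. by vm_compute. Qed.

Lemma certificate42 :
  let t0 := table pair_out42 in let t1 := table [::] in let t := table face42 in
  all_min_pat4 (fun A => Z.leb (sum_sym (fun A =>
    1887762240 * ind (count4 A == 2%N) + (rooted_pair t0 t1 A + rooted_face t A)) A)
    (384 * 1452971520)).
Proof. by vm_compute. Qed.

Lemma certificate44 : let t0 := table pair_out44 in let t1 := table pair_in44 in
  all_min_pat4 (fun A => Z.leb (sum_sym (fun A =>
    5832 * ind (count4 A == 4%N) + rooted_pair t0 t1 A) A) (384 * 5616)).
Proof. by vm_compute. Qed.

End Certificates.

(** * Counting pairs of a point and a tuple of directions *)

Lemma sum_tupleS (T : finType) d (g : seq T -> nat) :
  (\sum_(t : d.+1.-tuple T) g t = \sum_i \sum_(t : d.-tuple T) g (i :: t))%N.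
Proof.
rewrite pair_bigA (reindex (fun p : T * d.-tuple T => [tuple of p.1 :: p.2])) //=.
exists (fun t => (thead t, [tuple of behead t])) => [[i t] _|t _] /=.
  by congr (_, _); apply: val_inj.
by rewrite -tuple_eta.
Qed.

Lemma sum_tuple0 (T : finType) (g : seq T -> nat) :
  (\sum_(t : 0.-tuple T) g t = g [::])%N.
Proof. by rewrite (big_pred1 [tuple]) // => t; apply/esym/eqP; exact: tuple0. Qed.

Lemma sum_tuple3 (T : finType) (g : seq T -> nat) :
  (\sum_(t : 3.-tuple T) g t = \sum_i \sum_j \sum_k g [:: i; j; k])%N.
Proof.
rewrite sum_tupleS; apply: eq_bigr => i _.
rewrite (sum_tupleS _ (fun t => g (i :: t))); apply: eq_bigr => j _.
rewrite (sum_tupleS _ (fun t => g [:: i, j & t])); apply: eq_bigr => k _.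
exact: (sum_tuple0 (fun t => g [:: i, j, k & t])).
Qed.

Lemma sum_tuple4 (T : finType) (g : seq T -> nat) :
  (\sum_(t : 4.-tuple T) g t = \sum_i \sum_j \sum_k \sum_l g [:: i; j; k; l])%N.
Proof.
rewrite sum_tupleS; apply: eq_bigr => i _; exact: (sum_tuple3 (fun t => g (i :: t))).
Qed.

(** Repeated directions count points with multiplicity; this matches [count3] and [count4] of the
    trace by conversion. *)
Fixpoint subcount n (S : {set point n}) (t : seq 'I_n) (x : point n) : nat :=
  if t is i :: t' then subcount S t' x + subcount S t' (flip i x) else x \in S.

Definition good_pairs n (S : {set point n}) d s : nat :=
  \sum_x \sum_(t : d.-tuple 'I_n) (subcount S t x == s).

Lemma natrZ m : (m%:R : Z) = Z.of_nat m.
Proof. by elim: m => // m IHm; rewrite mulrS IHm Nat2Z.inj_succ -Z.add_1_l. Qed.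

Lemma leZ_nat (b c : Z) (g m : nat) :
  c * g%:R <= b *+ m -> Z.le (Z.mul c (Z.of_nat g)) (Z.mul b (Z.of_nat m)).
Proof. by rewrite -[b *+ m]mulr_natr !natrZ => /Z.leb_le. Qed.

Lemma total_count4 n (S : {set point n}) s :
  total S (fun A => ind (count4 A == s)) = (good_pairs S 4 s)%:R.
Proof.
rewrite total_nested natr_sum; apply: eq_bigr => x _.
rewrite (sum_tuple4 (fun t => nat_of_bool (subcount S t x == s))) natr_sum.
apply: eq_bigr => i _; rewrite natr_sum; apply: eq_bigr => j _.
rewrite natr_sum; apply: eq_bigr => k _; rewrite natr_sum; apply: eq_bigr => l _.
by rewrite [count4 _]/(subcount S [:: i; j; k; l] x); case: eqP.
Qed.

Lemma total_count3 n (S : {set point n}) s :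
  total S (fun A => ind (count3 (facet A) == s)) = (n * good_pairs S 3 s)%:R.
Proof.
rewrite total_nested mulnC natrM mulr_natr natr_sum -sumrMnl; apply: eq_bigr => x _.
rewrite (sum_tuple3 (fun t => nat_of_bool (subcount S t x == s))) natr_sum -sumrMnl.
apply: eq_bigr => i _; rewrite natr_sum -sumrMnl; apply: eq_bigr => j _.
rewrite natr_sum -sumrMnl; apply: eq_bigr => k _.
transitivity (\sum_(l < n) ((subcount S [:: i; j; k] x == s)%:R : Z)).
  apply: eq_bigr => l _.
  by rewrite [count3 _]/(subcount S [:: i; j; k] x); case: eqP.
by rewrite sumr_const card_ord.
Qed.

Lemma good_pairs32_le n (S : {set point n}) :
  (0 < n)%N -> (9 * good_pairs S 3 2 <= 8 * (2 ^ n * n ^ 3))%N.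
Proof.
move=> n_gt0.
have := total_bound (@total_rooted_edge n S edge_out32 edge_in32 isT isT) certificate32.
rewrite total_scale total_count3 => /leZ_nat; rewrite expnS mulnCA.
move: (2 ^ n * n ^ 3)%N (good_pairs S 3 2) => c g le_gc.
(* The free fourth direction gives both sides a factor n, cancelled here. *)
have : (n * (9 * g) <= n * (8 * c))%N by rewrite !(mulnCA n); lia.
by rewrite leq_pmul2l.
Qed.

Lemma good_pairs42_le n (S : {set point n}) :
  (343 * good_pairs S 4 2 <= 264 * (2 ^ n * n ^ 4))%N.
Proof.
have F_ge0 : 0 <= total S (fun A => rooted_pair (table pair_out42) (table [::]) A
    + rooted_face (table face42) A).
  by rewrite total_sum addr_ge0 ?total_rooted_pair ?total_rooted_face.
have := total_bound F_ge0 certificate42.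
rewrite total_scale total_count4 => /leZ_nat.
by move: (2 ^ n * n ^ 4)%N => c; lia.
Qed.

Lemma good_pairs44_le n (S : {set point n}) :
  (27 * good_pairs S 4 4 <= 26 * (2 ^ n * n ^ 4))%N.
Proof.
have := total_bound (@total_rooted_pair n S pair_out44 pair_in44 isT isT) certificate44.
rewrite total_scale total_count4 => /leZ_nat.
by move: (2 ^ n * n ^ 4)%N => c; lia.
Qed.

(** * Subcubes and tuples of directions *)

Section Faces.
Context (n : nat).
Implicit Types (S : {set point n}) (D : {set 'I_n}) (x y : point n) (t : seq 'I_n).

Definition face D x : {set point n} :=
  [set y : point n | [forall i, (i \notin D) ==> (y i == x i)]].

Lemma faceP D x y : reflect (forall i, i \notin D -> y i = x i) (y \in face D x).
Proof.
rewrite inE; apply: (iffP forallP) => yx i.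
  by move=> iD; apply/eqP; have /implyP := yx i; apply.
by apply/implyP => /yx ->.
Qed.

Lemma face_refl D x : x \in face D x.
Proof. by apply/faceP. Qed.

Lemma face_eq D x y : y \in face D x -> face D y = face D x.
Proof.
move=> /faceP yx; apply/setP => z; apply/faceP/faceP => zx i iD; rewrite zx //.
  exact: yx.
by rewrite yx.
Qed.

Lemma flip_face D x i : (flip i x \in face D x) = (i \in D).
Proof.
apply/faceP/idP => [fx|iD j jD].
  by apply/negPn/negP => /fx; rewrite ffunE eqxx; case: (x i).
by rewrite ffunE; case: eqP => [ji|]; [rewrite ji iD in jD | rewrite addbF].
Qed.

Lemma face_inj x : injective (face^~ x).
Proof. by move=> D D' eDD'; apply/setP => i; rewrite -!(flip_face _ x) eDD'. Qed.

Lemma faceU1 D x i : i \notin D -> face (i |: D) x = face D x :|: face D (flip i x).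
Proof.
move=> iD; apply/setP => y; rewrite in_setU.
apply/faceP/orP => [yx|[/faceP yx|/faceP yx] j]; last 2 first.
- by rewrite !inE negb_or => /andP[_ /yx].
- rewrite !inE negb_or => /andP[ji /yx ->].
  by rewrite ffunE (negPf ji) addbF.
have [yi|yi] := eqVneq (y i) (x i); [left|right]; apply/faceP => j jD.
  have [->//|ji] := eqVneq j i; by apply: yx; rewrite !inE negb_or ji.
rewrite ffunE; have [->|ji] := eqVneq j i.
  by move: yi; case: (y i) (x i) => [] [].
by rewrite addbF; apply: yx; rewrite !inE negb_or ji.
Qed.

Lemma face_flip_disjoint D x i : i \notin D -> face D x :&: face D (flip i x) = set0.
Proof.
move=> iD; apply/setP => y; rewrite in_setI [RHS]inE.
apply/negP => /andP[/faceP/(_ i iD) yi /faceP/(_ i iD)].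
by rewrite ffunE eqxx yi; case: (x i).
Qed.

Lemma subcount_card S t x :
  uniq t -> subcount S t x = #|S :&: face [set i in t] x|.
Proof.
elim: t x => [|i t IHt] x /=.
  have -> : face [set i in [::]] x = [set x].
    apply/setP => y; rewrite [RHS]inE; apply/faceP/eqP => [yx|-> //].
    by apply/ffunP => j; apply: yx; rewrite inE.
  move=> _; rewrite setIC; have [xS|xS] := boolP (x \in S).
    by rewrite (setIidPl _) ?cards1 ?sub1set.
  apply/esym/eqP; rewrite cards_eq0 -subset0; apply/subsetP => y.
  by rewrite !inE => /andP[/eqP ->]; rewrite (negPf xS).
move=> /andP[it ut]; rewrite !IHt //.
have iD : i \notin [set i in t] by rewrite inE.
have -> : [set j in i :: t] = i |: [set j in t] by apply/setP => j; rewrite !inE.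
rewrite faceU1 // setIUr cardsU setIACA setIid face_flip_disjoint // setI0.
by rewrite cards0 subn0.
Qed.

Lemma subcount_setT t x : subcount setT t x = (2 ^ size t)%N.
Proof.
by elim: t x => [|i t IHt] x /=; rewrite ?in_setT // !IHt addnn -mul2n expnS.
Qed.

Lemma card_face D x : #|face D x| = (2 ^ #|D|)%N.
Proof.
have := @subcount_card setT (enum D) x (enum_uniq _).
have -> : [set i in enum D] = D by apply/setP => i; rewrite inE mem_enum.
by rewrite subcount_setT -cardE setTI => ->.
Qed.

(** Double counting of pairs of a subcube and one of its points: a d-subcube has 2^d points and is
    determined by any of them together with its free directions. *)
Lemma LambdaS_faces S d s :
  (LambdaS S d s * 2 ^ d =
   \sum_x #|[set D : {set 'I_n} | (#|D| == d) && (#|S :&: face D x| == s)]|)%N.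
Proof.
set G := [set C : {set point n} | is_subcube d C && (#|S :&: C| == s)].
have GP x (C : {set point n}) :
    reflect (exists2 D : {set 'I_n},
      (#|D| == d) && (#|S :&: face D x| == s) & C = face D x)
    ((C \in G) && (x \in C)).
  apply: (iffP andP) => [[]|[D /andP[dD sD] ->]]; rewrite inE.
    move=> /andP[/existsP[D /existsP[a /andP[dD /eqP]]]].
    rewrite -/(face D a) => -> sC xa.
    by exists D; rewrite (face_eq xa) // dD.
  split; last exact: face_refl.
  by rewrite sD andbT; apply/existsP; exists D; apply/existsP; exists x; rewrite dD eqxx.
transitivity (\sum_(C in G) #|C|)%N.
  rewrite -sum_nat_const; apply: eq_bigr => C; rewrite inE => /andP[].
  by move=> /existsP[D /existsP[a /andP[/eqP dD /eqP ->]]] _; rewrite (card_face D a) dD.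
transitivity (\sum_(C in G) \sum_x (x \in C))%N.
  by apply: eq_bigr => C _; rewrite -sum1_card big_mkcond.
rewrite exchange_big; apply: eq_bigr => x _.
transitivity #|[set C in G | x \in C]|.
  by rewrite -sum1dep_card big_mkcondr; apply: eq_bigr => C _; case: (x \in C).
rewrite -(card_in_imset (in2W (@face_inj x))); apply: eq_card => C; rewrite inE.
by apply/GP/imsetP => -[D PD ->]; exists D; rewrite ?inE // in PD *.
Qed.

Lemma card_tuples_onto d D :
  #|D| = d -> #|[set t : d.-tuple 'I_n | uniq t & [set i in t] == D]| = d`!.
Proof.
move=> dD; transitivity (#|D| ^_ d)%N; last by rewrite dD ffactnn.
rewrite -card_uniq_tuples; apply: eq_card => t.
rewrite !inE andbC; apply: andb_id2r => ut; apply/eqP/allP => [<- i it|tD].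
  by rewrite -[X in is_true X]/(i \in [set j in t]) inE.
apply/eqP; rewrite eqEcard dD; apply/andP; split.
  by apply/subsetP => i; rewrite inE => /tD.
by rewrite cardsE (card_uniqP ut) size_tuple.
Qed.

Lemma LambdaS_tuples S d s :
  (LambdaS S d s * 2 ^ d * d`! =
   \sum_x \sum_(t : d.-tuple 'I_n | uniq t) (subcount S t x == s))%N.
Proof.
rewrite LambdaS_faces big_distrl; apply: eq_bigr => x _ /=.
rewrite (partition_big (fun t : d.-tuple _ => [set i in t])
  (fun D => #|D| == d)) /=; last first.
  by move=> t ut; rewrite cardsE (card_uniqP ut) size_tuple.
rewrite -sum1_card big_mkcond big_distrl [RHS]big_mkcond /=; apply: eq_bigr => D _.
rewrite inE; case: eqP => //= dD.
transitivity (\sum_(t : d.-tuple 'I_n | uniq t && ([set i in t] == D))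
    (#|S :&: face D x| == s))%N; last first.
  by apply: eq_bigr => t /andP[ut /eqP tD]; rewrite subcount_card // tD.
rewrite sum_nat_const -(card_tuples_onto dD) mulnC; congr (_ * _)%N.
by apply: eq_card => t; rewrite !inE.
Qed.

Lemma LambdaS_le_good_pairs S d s :
  (LambdaS S d s * 2 ^ d * d`! <= good_pairs S d s)%N.
Proof.
rewrite LambdaS_tuples; apply: leq_sum => x _.
by rewrite [leqRHS](bigID (fun t : d.-tuple _ => uniq t)) leq_addr.
Qed.

(** At worst every tuple with a repetition is good; the number of these is moved across additively
    to avoid truncated subtraction. *)
Lemma good_pairs_le_LambdaS S d s :
  (good_pairs S d s + 2 ^ n * n ^_ d <= LambdaS S d s * 2 ^ d * d`! + 2 ^ n * n ^ d)%N.
Proof.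
rewrite LambdaS_tuples.
have -> : (2 ^ n * n ^_ d = \sum_(x : point n) \sum_(t : d.-tuple 'I_n | uniq t) 1)%N.
  rewrite sum_nat_const card_ffun card_bool card_ord; congr (_ * _)%N.
  rewrite -[n in LHS]card_ord -card_uniq_tuples sum1dep_card; apply: eq_card => t.
  by rewrite !inE; case: allP => // -[].
have -> : (2 ^ n * n ^ d = \sum_(x : point n) \sum_(t : d.-tuple 'I_n) 1)%N.
  by rewrite sum_nat_const card_ffun card_bool card_ord sum1_card card_tuple card_ord.
rewrite -!big_split; apply: leq_sum => x _ /=.
rewrite (bigID (fun t : d.-tuple _ => uniq t)) /=.
rewrite [X in (_ <= _ + X)%N](bigID (fun t : d.-tuple _ => uniq t)) /=.
rewrite -!addnA leq_add2l addnC leq_add2l.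
by apply: leq_sum => t _; case: eqP.
Qed.

End Faces.

(** * Linear configurations over the field with two elements *)

Definition vec := (bool * bool * bool)%type.
Definition vzero : vec := (false, false, false).
Definition vadd (u v : vec) : vec := (u.1.1 (+) v.1.1, u.1.2 (+) v.1.2, u.2 (+) v.2).

Fixpoint vcount (Z : pred vec) (vs : seq vec) (u : vec) : nat :=
  if vs is v :: vs' then vcount Z vs' u + vcount Z vs' (vadd u v) else Z u.

(** For a kernel of codimension r and s = 2^(d-r), this singles out the label tuples that span
    F_2^r. *)
Definition uniform_count Z s (vs : seq vec) :=
  allb (fun a => allb (fun b => allb (fun c => vcount Z vs (a, b, c) == s))).

Lemma uniform_countP Z s vs u : uniform_count Z s vs -> vcount Z vs u = s.
Proof.
case: u => [[a b] c].
move=> /andP[/andP[/andP[? ?] /andP[? ?]] /andP[/andP[? ?] /andP[? ?]]].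
by apply/eqP; case: a b c => [] [] [].
Qed.

Section Linear.
Context (n : nat) (w : 'I_n -> vec) (Z : pred vec).

Definition parity (b : 'I_n -> bool) (x : point n) : bool :=
  \big[addb/false]_i (x i && b i).

Definition vsum (x : point n) : vec :=
  (parity (fun i => (w i).1.1) x, parity (fun i => (w i).1.2) x,
   parity (fun i => (w i).2) x).

Definition vker : {set point n} := [set x | Z (vsum x)].

Lemma parity_flip b i x : parity b (flip i x) = parity b x (+) b i.
Proof.
rewrite /parity -[b i in RHS](big_pred1_eq addb i b) [X in _ (+) X]big_mkcond -big_split.
by apply: eq_bigr => j _ /=; rewrite ffunE; case: (j == i) (x j) (b j) => [] [] [].
Qed.

Lemma subcount_vker t x : subcount vker t x = vcount Z [seq w i | i <- t] (vsum x).
Proof.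
elim: t x => [|i t IHt] x /=; first by rewrite inE.
by rewrite !IHt; congr (_ + vcount _ _ _)%N; rewrite /vsum !parity_flip.
Qed.

End Linear.

Fixpoint sum_seqs T (l : seq T) d (g : seq T -> nat) : nat :=
  if d is e.+1 then sumn [seq sum_seqs l e (fun vs => g (v :: vs)) | v <- l] else g [::].

(** Only the complete periods of the labelling are kept. *)
Lemma sum_cyclic T (x0 : T) (l : seq T) n (h : T -> nat) :
  (n %/ size l * sumn (map h l) <= \sum_(i < n) h (nth x0 l (i %% size l)))%N.
Proof.
have periodic q : (\sum_(0 <= i < q * size l) h (nth x0 l (i %% size l)) =
    q * sumn (map h l))%N.
  elim: q => [|q IHq]; first by rewrite !mul0n big_nil.
  rewrite !mulSn (@big_cat_nat _ _ _ (size l)) ?leq_addr //=; congr (_ + _)%N.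
    rewrite sumnE big_map (big_nth x0) big_nat_cond [RHS]big_nat_cond.
    by apply: eq_bigr => i; rewrite andbT => /= il; rewrite modn_small.
  rewrite -[X in index_iota X]add0n big_addn addKn -IHq.
  by apply: eq_bigr => i _; rewrite modnDr.
rewrite -periodic -(big_mkord predT (fun i => h (nth x0 l (i %% size l)))).
by rewrite [leqRHS](@big_cat_nat _ _ _ (n %/ size l * size l)) ?leq_trunc_div // leq_addr.
Qed.

Lemma sum_tuple_cyclic T (x0 : T) (l : seq T) n d (g : seq T -> nat) :
  ((n %/ size l) ^ d * sum_seqs l d g <=
   \sum_(t : d.-tuple 'I_n) g [seq nth x0 l (i %% size l) | i : 'I_n <- t])%N.
Proof.
pose lab (i : 'I_n) := nth x0 l (i %% size l).
elim: d g => [|d IHd] g.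
  by rewrite (sum_tuple0 (fun t => g (map lab t))) mul1n.
rewrite (sum_tupleS _ (fun t => g (map lab t))).
pose h v := sum_seqs l d (fun vs => g (v :: vs)).
apply: (@leq_trans (\sum_(i < n) (n %/ size l) ^ d * h (nth x0 l (i %% size l)))%N).
  by rewrite -big_distrr expnSr -mulnA leq_mul2l sum_cyclic orbT.
by apply: leq_sum => i _; apply: (IHd (fun vs => g (_ :: vs))).
Qed.

Lemma good_pairs_vker_ge (l : seq vec) Z n d s :
  (2 ^ n * ((n %/ size l) ^ d * sum_seqs l d (uniform_count Z s)) <=
   good_pairs (vker (fun i : 'I_n => nth vzero l (i %% size l)) Z) d s)%N.
Proof.
have -> : (2 ^ n = #|{: point n}|)%N by rewrite card_ffun card_bool card_ord.
rewrite -sum_nat_const; apply: leq_sum => x _.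
apply: leq_trans (sum_tuple_cyclic vzero l n d (uniform_count Z s)) _.
apply: leq_sum => t _; rewrite subcount_vker.
by case: (boolP (uniform_count Z s _)) => // /(@uniform_countP Z s) ->; rewrite eqxx.
Qed.

(** * Passage to the limit *)

Section Limits.
Local Open Scope classical_set_scope.
Context (R : realType).

Lemma cvg_invn : (fun n : nat => n%:R^-1 : R) @ \oo --> (0 : R).
Proof. by rewrite -cvg_shiftS; exact: cvg_harmonic. Qed.

Lemma cvg_ffact_ratio d :
  (fun n : nat => (n ^_ d)%:R / n%:R ^+ d : R) @ \oo --> (1 : R).
Proof.
elim: d => [|d IHd].
  by under eq_fun do rewrite ffactn0 expr0 divr1; exact: cvg_cst.
have linear : (fun n : nat => 1 - d%:R * n%:R^-1 : R) @ \oo --> (1 : R).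
  rewrite -[X in _ --> X](_ : 1 - d%:R * 0 = 1); last by rewrite mulr0 subr0.
  by apply: cvgB; [exact: cvg_cst | apply: cvgM; [exact: cvg_cst | exact: cvg_invn]].
have lim : (fun n : nat => (n ^_ d)%:R / n%:R ^+ d * (1 - d%:R * n%:R^-1) : R) @ \oo
    --> (1 : R) by rewrite -[X in _ --> X]mulr1; apply: cvgM IHd linear.
apply: cvg_trans lim; apply: near_eq_cvg.
near=> n; have dn : (d < n)%N by near: n; exact: nbhs_infty_gt.
have n0 : n%:R != 0 :> R by rewrite pnatr_eq0 -lt0n (leq_ltn_trans _ dn).
rewrite /= ffactnSr natrM natrB ?(ltnW dn) // exprSr invfM mulrACA.
by congr (_ * _); rewrite mulrBl divff.
Unshelve. all: by end_near.
Qed.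

(** A squeeze: [M] of the [size l ^ d] label tuples are good, a proportion a/b, which the linear
    configuration attains asymptotically and [upper] forbids exceeding. *)
Lemma lambda_ratio_cvg (l : seq vec) (Z : pred vec) (d s M a b : nat) :
    (0 < size l)%N -> (0 < b)%N ->
    sum_seqs l d (uniform_count Z s) = M -> (b * M = a * size l ^ d)%N ->
    (forall n (S : {set point n}), (0 < n)%N ->
      b * good_pairs S d s <= a * (2 ^ n * n ^ d))%N ->
  lambda_ratio R d s @ \oo --> (a%:R / b%:R : R).
Proof.
move=> m_gt0 b_gt0 sumM Mab upper.
have bR0 : b%:R != 0 :> R by rewrite pnatr_eq0 -lt0n.
have mR0 : (size l)%:R != 0 :> R by rewrite pnatr_eq0 -lt0n.
pose rho n : R := (n ^_ d)%:R / n%:R ^+ d.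
have rhoV : (fun n => (rho n)^-1) @ \oo --> (1 : R).
  rewrite -[X in _ --> X]invr1.
  by apply: cvgV; [exact: oner_neq0 | exact: cvg_ffact_ratio].
(* The difference of inverses bounds the share of indices per label in complete periods from below;
   [rho n - 1] pays for tuples with repetitions. *)
pose low n : R := (M%:R * ((size l)%:R^-1 - n%:R^-1) ^+ d + (rho n - 1)) * (rho n)^-1.
pose up n : R := a%:R / b%:R * (rho n)^-1.
apply: (@squeeze_cvgr _ _ _ _ low up).
- near=> n.
  have n_gt0 : (0 < n)%N by near: n; exact: nbhs_infty_gt.
  have dn : (d <= n)%N by near: n; exact: nbhs_infty_ge.
  have mn : (size l <= n)%N by near: n; exact: nbhs_infty_ge.
  have nR0 : n%:R != 0 :> R by rewrite pnatr_eq0 -lt0n.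
  have nd_gt0 : 0 < n%:R ^+ d :> R by rewrite exprn_gt0 // ltr0n.
  have e_gt0 : 0 < 2 ^+ n :> R by rewrite exprn_gt0.
  have f_gt0 : 0 < (n ^_ d)%:R :> R by rewrite ltr0n ffact_gt0.
  (* The maximal share of pairs of a point and an injective good tuple, among all pairs of a point
     and a tuple. *)
  pose y : R := (Lambda n d s * 2 ^ d * d`!)%:R / 2 ^+ n / n%:R ^+ d.
  have -> : lambda_ratio R d s n = y * (rho n)^-1.
    rewrite /lambda_ratio /y /rho invf_div.
    have -> : ('C(n, d) * 2 ^ (n - d))%:R = (n ^_ d)%:R * 2 ^+ n / (2 ^ d * d`!)%:R :> R.
      apply/(canRL (mulfK _)).
        by rewrite pnatr_eq0 muln_eq0 negb_or expn_eq0 /= -lt0n fact_gt0.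
      rewrite -natrX -!natrM; congr (_%:R).
      by rewrite [(2 ^ d * _)%N]mulnC mulnACA bin_ffact -expnD subnK.
    rewrite -mulnA [(Lambda n d s * _)%:R]natrM invf_div mulrA [RHS]mulrA divfK ?lt0r_neq0 //.
    by rewrite [(n ^_ d)%:R * _]mulrC [(2 ^+ n * _)^-1]invfM mulrA.
  have rho_gt0 : 0 < (rho n)^-1 by rewrite invr_gt0 divr_gt0.
  rewrite /low /up !ler_pM2r //; apply/andP; split.
    pose S := vker (fun i : 'I_n => nth vzero l (i %% size l)) Z.
    have lowS := good_pairs_le_LambdaS S d s.
    have {}lowS : (2 ^ n * ((n %/ size l) ^ d * M) + 2 ^ n * n ^_ d <=
        Lambda n d s * 2 ^ d * d`! + 2 ^ n * n ^ d)%N.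
      apply: leq_trans (leq_trans _ lowS) _.
        by rewrite leq_add2r -sumM good_pairs_vker_ge.
      by rewrite leq_add2r !leq_mul2r (leq_bigmax S) !orbT.
    have {}lowS : (n %/ size l)%:R ^+ d * M%:R + (n ^_ d)%:R <=
        (Lambda n d s * 2 ^ d * d`!)%:R / 2 ^+ n + n%:R ^+ d :> R.
      rewrite -(ler_pM2l e_gt0) mulrDr [leRHS]mulrDr [_ * (_ / _)]mulrC.
      rewrite divfK ?lt0r_neq0 //.
      by rewrite -!natrX -!natrM -!natrD ler_nat.
    have mono : ((size l)%:R^-1 - n%:R^-1) ^+ d <= (n %/ size l)%:R ^+ d / n%:R ^+ d :> R.
      rewrite -exprVn -exprMn lerXn2r ?nnegrE ?divr_ge0 //.
        by rewrite subr_ge0 lef_pV2 ?posrE ?ltr0n // ler_nat.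
      rewrite ler_pdivlMr ?ltr0n // mulrBl mulVf // lerBlDr.
      rewrite -(ler_pM2l (_ : 0 < (size l)%:R)) ?ltr0n //.
      rewrite mulrA divff // mul1r mulrDr mulr1 -natrM -natrD ler_nat.
      by rewrite {1}(divn_eq n (size l)) mulnC leq_add2l ltnW // ltn_mod.
    apply: (@le_trans _ _ (((n %/ size l)%:R ^+ d * M%:R + (n ^_ d)%:R) / n%:R ^+ d - 1)).
      rewrite mulrDl -addrA lerD2r mulrC.
      by rewrite -mulrA [M%:R * _]mulrC mulrA ler_wpM2r.
    by rewrite lerBlDr ler_pdivrMr // mulrDl mul1r divfK // lt0r_neq0.
  have [|S eS] := @bigop.eq_bigmax _ (fun S : {set point n} => LambdaS S d s).
    by apply/card_gt0P; exists set0.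
  rewrite /y /Lambda eS ler_pdivrMr // ler_pdivrMr //.
  rewrite -[X in _ <= X]mulrA mulrAC ler_pdivlMr ?ltr0n //.
  rewrite -natrX -[2 ^+ n]natrX -!natrM ler_nat.
  apply: leq_trans (_ : b * good_pairs S d s <= _)%N.
    by rewrite mulnC leq_mul2l LambdaS_le_good_pairs orbT.
  by rewrite [(n ^ d * _)%N]mulnC upper.
- have -> : a%:R / b%:R = (M%:R * ((size l)%:R^-1 - 0) ^+ d + (1 - 1)) * 1 :> R.
    rewrite subrr addr0 mulr1 subr0 exprVn; apply/eqP.
    rewrite eqr_div ?expf_neq0 // -natrX -!natrM eqr_nat.
    by rewrite -Mab mulnC.
  apply: cvgM rhoV; apply: cvgD.
    apply: cvgM; first exact: cvg_cst.
    have := @exprn_continuous R d ((size l)%:R^-1 - 0).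
    by apply: cvg_comp; apply: cvgB; [exact: cvg_cst | exact: cvg_invn].
  by apply: cvgB; [exact: cvg_ffact_ratio | exact: cvg_cst].
- rewrite -[X in _ --> X]mulr1; apply: cvgM rhoV; exact: cvg_cst.
Unshelve. all: by end_near.
Qed.

End Limits.

(* For two dimensions the third coordinate of [vec] is ignored. *)
Definition vecs2 : seq vec :=
  [:: (true, false, false); (false, true, false); (true, true, false)].
Definition vecs3 : seq vec :=
  [:: (true, false, false); (false, true, false); (true, true, false);
      (false, false, true); (true, false, true); (false, true, true); (true, true, true)].

Local Open Scope classical_set_scope.
Local Open Scope ring_scope.

Theorem theorem1p3 (R : realType) :
  [/\ lambda_ratio R 3 2 @ \oo --> (8 / 9 : R),
      lambda_ratio R 4 2 @ \oo --> (264 / 343 : R)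
    & lambda_ratio R 4 4 @ \oo --> (26 / 27 : R)].
Proof.
split.
(* The numbers 24, 1848 and 78 count the spanning tuples among the 3^3, 7^4 and 3^4 tuples of
   nonzero labels. *)
- apply: (@lambda_ratio_cvg R vecs2 (fun u => u.1 == (false, false)) 3 2 24) => //.
  exact: good_pairs32_le.
- apply: (@lambda_ratio_cvg R vecs3 (pred1 vzero) 4 2 1848) => [//|//||/=|n S _].
  + by vm_compute.
  + by lia.
  + exact: good_pairs42_le.
- apply: (@lambda_ratio_cvg R vecs2 (fun u => u.1 == (false, false)) 4 4 78) => // n S _.
  exact: good_pairs44_le.
Qed.
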